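(* For each positive integer $n$ let $Q$ be a random real symmetric $n\times n$ matrix whose diagonal entries $(Q_{ii})_i$ and off-diagonal entries $(Q_{ij})_{i<j}$ are mutually independent, the diagonal entries being i.i.d. with distribution function $F_D$ and the off-diagonal entries being i.i.d. with distribution function $F_O$, both laws absolutely continuous with respect to Lebesgue measure. Let $m_n:=\min_{1\le i\le n}Q_{ii}$. Assume that both laws have a common finite lower endpoint $-a$ ($a\in\mathbb{R}$) and satisfy $$F_D(-a+t)\sim c_Dt^{\beta_D},\qquad F_O(-a+t)\sim c_Ot^{\beta_O},\qquad t\downarrow0,$$ with $c_D,c_O>0$ and $\beta_D,\beta_O>0$. If $$\beta_O>\frac54\,\beta_D,$$ then $n^5\,\mathbb{E}\bigl[F_O(m_n)^4\bigr]\to0$ as $n\to\infty$.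
   Context: $f(t)\sim g(t)$ as $t\downarrow0$ means $f(t)/g(t)\to1$. The lower endpoint of a law with distribution function $F$ is $\inf\{x: F(x)>0\}$. *)

(* Defs.v *)
From HB Require Import structures.
From mathcomp Require Import all_boot all_order all_algebra.
From mathcomp Require Import all_classical all_reals all_analysis.

Set Implicit Arguments.
Unset Strict Implicit.
Unset Printing Implicit Defensive.

Import Order.TTheory GRing.Theory Num.Theory.
Import numFieldNormedType.Exports.

Local Open Scope classical_set_scope.
Local Open Scope ring_scope.

Definition distribution_function (R : realType)
    (mu : probability (measurableTypeR R) R) (x : R) : R :=
  fine (mu `]-oo, x]%classic).

(* The infimum is taken in the extended reals, so that a finite value entails
   that the set is nonempty and bounded below. *)
Definition lower_endpoint (R : realType) (F : R -> R) : \bar R :=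
  ereal_inf (EFin @` [set x | 0 < F x]).

Definition mutually_independent (d : measure_display) (T : measurableType d)
    (R : realType) (P : probability T R) (I : finType) (D : {pred I})
    (X : I -> {RV P >-> R}) : Prop :=
  forall (J : {set I}) (B : I -> set R),
    J \subset D -> (forall i, measurable (B i)) ->
    P (\bigcap_(i in [set` J]) (X i @^-1` B i)) =
    (\prod_(i in J) P (X i @^-1` B i))%E.

(* The default value of the iterated minimum is itself one of the diagonal
   entries, so this is the minimum of the diagonal. *)
Definition min_diag (d : measure_display) (T : measurableType d)
    (R : realType) (P : probability T R) (n : nat)
    (Q : 'M[{RV P >-> R}]_n.+1) (w : T) : R :=
  \big[Num.min/Q ord0 ord0 w]_(i < n.+1) Q i i w.

(* Main.v *)
Require Import Defs.
From HB Require Import structures.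
From mathcomp Require Import all_boot all_order all_algebra.
From mathcomp Require Import all_classical all_reals all_analysis.
From mathcomp Require Import measurable_realfun lra.

Set Implicit Arguments.
Unset Strict Implicit.
Unset Printing Implicit Defensive.

Import Order.TTheory GRing.Theory Num.Theory.
Import numFieldNormedType.Exports.

Local Open Scope classical_set_scope.
Local Open Scope ring_scope.

(* With N = n + 1 the number of diagonal entries and m the diagonal minimum,
   split according to whether m exceeds a threshold x.  Since FO is
   nondecreasing and at most 1, and P(m > x) = (1 - FD x)^N,
     E[FO(m)^4] <= FO(x)^4 + (1 - FD x)^N.
   Take x = -a + N^(-s) with 5 / (4 bO) < s < 1 / bD, an interval which is
   nonempty by hypothesis.  The first term is O(N^(-4 s bO)), hence o(N^(-5)),
   and the second at most exp(-N FD(x)) <= exp(-(cD / 2) N^(1 - s bD)), which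
   decays faster than any power of N. *)

Lemma distribution_function_ge0 (R : realType)
    (mu : probability (measurableTypeR R) R) (x : R) :
  0 <= distribution_function mu x.
Proof. by rewrite fine_ge0. Qed.

Lemma distribution_function_le1 (R : realType)
    (mu : probability (measurableTypeR R) R) (x : R) :
  distribution_function mu x <= 1.
Proof.
rewrite -lee_fin fineK ?probability_le1//.
exact: fin_num_measure.
Qed.

Lemma distribution_function_nondecreasing (R : realType)
    (mu : probability (measurableTypeR R) R) :
  nondecreasing_fun (distribution_function mu).
Proof.
move=> x y xy; apply: fine_le; [exact: fin_num_measure..|].
apply: le_measure; rewrite ?inE; [exact: measurable_itv..|].
by move=> z /=; rewrite !in_itv/= => /le_trans; apply.
Qed.

Section MinDiag.
Context d (T : measurableType d) (R : realType) (P : probability T R) (n : nat).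
Variable Q : 'M[{RV P >-> R}]_n.+1.

Lemma measurable_min_diag : measurable_fun [set: T] (min_diag Q).
Proof.
(* Induction on the list of indices; on the empty list the minimum is its default value, itself a
   random variable. *)
rewrite /min_diag; elim: (index_enum _) => [|i s ih].
  by under eq_fun do rewrite big_nil; exact: measurable_funPT.
under eq_fun do rewrite big_cons.
by apply: measurable_minr => //; exact: measurable_funPT.
Qed.

(** The event is indexed by the pairs [(i, i)], the shape to which [mutually_independent]
    applies. *)
Lemma min_diag_gt (x : R) :
  [set w | x < min_diag Q w] =
  \bigcap_(ij in [set` [set (i, i) | i : 'I_n.+1]%SET])
    (Q ij.1 ij.2 @^-1` `]x, +oo[).
Proof.
apply/seteqP; split => [w xm _ /imsetP[i _ ->] /=|w xQ /=].
  rewrite in_itv/= andbT; apply: lt_le_trans xm _.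
  exact: bigmin_le_cond.
(* This covers the default value of the minimum, the entry at [ord0], as well as the terms. *)
have xQi i : x < Q i i w.
  by have := xQ (i, i) (imset_f _ isT); rewrite /= in_itv/= andbT.
by apply/lt_bigmin.
Qed.

Lemma prob_min_diag_gt (F : R -> R) (x : R) :
  mutually_independent [pred ij : 'I_n.+1 * 'I_n.+1 | (ij.1 <= ij.2)%N]
    (fun ij => Q ij.1 ij.2) ->
  (forall i, cdf (Q i i) x = (F x)%:E) ->
  P [set w | x < min_diag Q w] = ((1 - F x) ^+ n.+1)%:E.
Proof.
move=> indQ QF; rewrite min_diag_gt indQ; last 2 first.
- by apply/fintype.subsetP => _ /imsetP[i _ ->]; rewrite inE/=.
- by move=> i; exact: measurable_itv.
rewrite big_imset/=; last by move=> i j _ _ [].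
transitivity (\prod_(i in 'I_n.+1) (1 - F x)%:E)%E.
  apply: eq_bigr => i _.
  (* [cdf] measures the closed left ray, so each factor is the probability of a complement. *)
  have -> : `]x, +oo[%classic = ~` `]-oo, x]%classic by rewrite setCitvl.
  rewrite preimage_setC probability_setC; last first.
    exact: (measurable_funPTI (Q i i) (measurable_itv _)).
  by rewrite EFinB; congr (1 - _)%E; exact: QF.
by rewrite prodEFin prodr_const card_ord.
Qed.

(** Integrates the pointwise bound of [G m ^+ k] by [G x ^+ k] plus the indicator of [x < m], where
    [m] is the minimum: on that event [G] is at most 1, and off it monotonicity applies. *)
Lemma expectation_min_diag_le (F G : R -> R) (k : nat) (x : R) :
  mutually_independent [pred ij : 'I_n.+1 * 'I_n.+1 | (ij.1 <= ij.2)%N]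
    (fun ij => Q ij.1 ij.2) ->
  (forall i, cdf (Q i i) x = (F x)%:E) ->
  nondecreasing_fun G -> (forall y, 0 <= G y <= 1) ->
  ('E_P[fun w => (G (min_diag Q w) ^+ k)%R] <=
    (G x ^+ k + (1 - F x) ^+ n.+1)%:E)%E.
Proof.
move=> indQ QF Gnd G01.
have G0 y : 0 <= G y by case/andP: (G01 y).
have G1 y : G y <= 1 by case/andP: (G01 y).
have mA : measurable [set w | x < min_diag Q w].
  rewrite -[X in measurable X]setTI.
  have -> : [set w | x < min_diag Q w] = min_diag Q @^-1` `]x, +oo[%classic.
    by apply/seteqP; split => w /=; rewrite in_itv/= andbT.
  exact: measurable_min_diag.
have mGm : measurable_fun setT (fun w => G (min_diag Q w) ^+ k).
  apply: measurable_funX; apply: (measurableT_comp _ measurable_min_diag).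
  exact: nondecreasing_measurable.
rewrite EFinD -(prob_min_diag_gt indQ QF) -expectation_indic//.
rewrite -(expectation_cst P) !unlock -ge0_integralD//=.
- apply: ge0_le_integral => //=.
  + by move=> w _; rewrite lee_fin exprn_ge0.
  + exact/measurable_EFinP.
  + by apply: emeasurable_funD => //; exact/measurable_EFinP.
  + move=> w _; rewrite -EFinD lee_fin indicE.
    have [xm|mx] := ltP x (min_diag Q w).
      rewrite mem_set//=; apply: (@le_trans _ _ 1); first exact: exprn_ile1.
      by rewrite lerDr exprn_ge0.
    by rewrite memNset/= ?addr0 ?lerXn2r ?nnegrE ?Gnd//; apply/negP; rewrite -leNgt.
- by move=> w _; rewrite lee_fin exprn_ge0.
- exact/measurable_EFinP.
Qed.

End MinDiag.

(** Allows positive quantities tending to 0 to be substituted into limits at [0^'+]. *)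
Lemma cvg_at_right_intro (R : numFieldType) (I : Type) (F : set_system I)
    (f : I -> R) (x : R) : Filter F ->
  (\forall i \near F, x < f i) -> f i @[i --> F] --> x ->
  f i @[i --> F] --> x^'+.
Proof.
move=> FF xf fx A /= /fx A'; rewrite /nbhs/=.
by apply: filterS2 A' xf => i /=; apply.
Qed.

(** Combines [1 - p <= expR (- p)] with [y ^+ k / k! <= expR y] at [y = p * N]. The result is
    polynomial decay of any chosen order, with an explicit constant. *)
Lemma exprB1_le_factorial (R : realType) (p : R) (N k : nat) :
  0 < p <= 1 -> (0 < N)%N ->
  (1 - p) ^+ N <= k`!%:R / (p * N%:R) ^+ k.
Proof.
move=> /andP[p0 p1] N0.
have pN0 : 0 < p * N%:R by rewrite mulr_gt0// ltr0n.
have /le_trans : (1 - p) ^+ N <= (expR (p * N%:R))^-1.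
  rewrite -expRN -mulNr mulrC expRM_natl lerXn2r// ?nnegrE ?expR_ge0 ?subr_ge0//.
  exact: expR_ge1Dx.
apply.
rewrite -[leRHS]invf_div lef_pV2 ?posrE ?expR_gt0 ?divr_gt0 ?exprn_gt0 ?ltr0n ?fact_gt0//.
(* The series bound [expR_ge1Dxn] concerns positive powers, so order 0 is treated apart. *)
case: k => [|k]; first by rewrite expr0 fact0 divr1 -[leLHS]expR0 ler_expR ltW.
by rewrite (le_trans _ (expR_ge1Dxn k (ltW pN0)))// lerDr.
Qed.

(** A ratio tending to 1 eventually lies between 1/2 and 2. *)
Lemma near_powR_bounds (R : realType) (F : R -> R) (a c b : R) : 0 < c ->
  F (a + t) / (c * t `^ b) @[t --> 0^'+] --> (1 : R) ->
  \forall t \near 0^'+, c / 2 * t `^ b <= F (a + t) <= 2 * c * t `^ b.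
Proof.
move=> c0 Fc.
have lo : (2^-1 : R) < 1 by rewrite invf_lt1 ?ltr1n.
have hi : (1 : R) < 2 by rewrite ltr1n.
near=> t.
have t0 : 0 < t by near: t; exact: nbhs_right_gt.
have ct0 : 0 < c * t `^ b by rewrite mulr_gt0 ?powR_gt0.
rewrite [c / 2]mulrC -!mulrA -ler_pdivrMr// -[2^-1 * _ <= _]ler_pdivlMr//.
apply/andP; split; apply: ltW; near: t.
  exact: (cvgr_gt _ Fc).
exact: (cvgr_lt _ Fc).
Unshelve. all: by end_near. Qed.

(** In terms of [h = 1 / N], both summands are dominated by constants times positive powers of [h].
    Here [a] denotes the endpoint itself, so the theorem instantiates it with [- a]. *)
Lemma threshold_bound_cvg0 (R : realType) (FD FO : R -> R)
    (a cD cO bD bO s : R) (m k : nat) :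
  0 < cD -> 0 < cO -> 0 < s -> s * bD < 1 -> m%:R < k%:R * (s * bO) ->
  (forall x, FD x <= 1) -> (forall x, 0 <= FO x) ->
  FD (a + t) / (cD * t `^ bD) @[t --> 0^'+] --> (1 : R) ->
  FO (a + t) / (cO * t `^ bO) @[t --> 0^'+] --> (1 : R) ->
  n.+1%:R ^+ m * (FO (a + n.+1%:R^-1 `^ s) ^+ k +
    (1 - FD (a + n.+1%:R^-1 `^ s)) ^+ n.+1) @[n --> \oo] --> (0 : R).
Proof.
move=> cD0 cO0 s0 sbD sbO FD1 FO0 asD asO.
have d0 : 0 < 1 - s * bD by rewrite subr_gt0.
(* Since [p * N] is at least of order [N ^ (1 - s * bD)], decay of this order [j] in [p * N] beats
   the factor [N ^ m]. *)
have [j jd] : exists j : nat, m%:R < j%:R * (1 - s * bD).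
  exists (Num.bound (m%:R / (1 - s * bD))).
  by rewrite -ltr_pdivrMr// archi_boundP// divr_ge0// ltW.
(* The majorant: its first term comes from the upper bound on [FO], its second from the lower bound
   on [FD] and the factorial estimate. *)
pose B (h : R) := (2 * cO) ^+ k * h `^ (k%:R * (s * bO) - m%:R) +
  j`!%:R / (cD / 2) ^+ j * h `^ (j%:R * (1 - s * bD) - m%:R).
have B0 : B h @[h --> 0^'+] --> (0 : R).
  have cvg0 (c r : R) : 0 < r -> c * h `^ r @[h --> 0^'+] --> (0 : R).
    by move=> r0; rewrite -[X in _ --> X](mulr0 c); apply: cvgMr; exact: powR_cvg0.
  rewrite -[X in _ --> X]addr0.
  by apply: cvgD; apply: cvg0; rewrite subr_gt0.
have invn : n.+1%:R^-1 @[n --> \oo] --> (0 : R)^'+.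
  apply: cvg_at_right_intro; last exact: cvg_harmonic.
  by near=> n; rewrite invr_gt0 ltr0n.
have powS : h `^ s @[h --> (0 : R)^'+] --> (0 : R)^'+.
  apply: cvg_at_right_intro; last exact: powR_cvg0.
  by near=> h; rewrite powR_gt0//; near: h; exact: nbhs_right_gt.
apply: (@squeeze_cvgr _ _ _ _ (cst 0) (fun n => B n.+1%:R^-1)); last 2 first.
- exact: cvg_cst.
- exact: (cvg_comp _ _ invn B0).
pose t n : R := n.+1%:R^-1 `^ s.
have t0 : t n @[n --> \oo] --> (0 : R)^'+ by exact: (cvg_comp _ _ invn powS).
have nearD : \forall n \near \oo,
    cD / 2 * t n `^ bD <= FD (a + t n) <= 2 * cD * t n `^ bD.
  exact: (t0 _ (near_powR_bounds cD0 asD)).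
have nearO : \forall n \near \oo,
    cO / 2 * t n `^ bO <= FO (a + t n) <= 2 * cO * t n `^ bO.
  exact: (t0 _ (near_powR_bounds cO0 asO)).
near=> n.
have /andP[FDlo _] : cD / 2 * t n `^ bD <= FD (a + t n) <= 2 * cD * t n `^ bD.
  by near: n.
have /andP[_ FOhi] : cO / 2 * t n `^ bO <= FO (a + t n) <= 2 * cO * t n `^ bO.
  by near: n.
rewrite /t in FDlo FOhi.
set h : R := n.+1%:R^-1 in FDlo FOhi *.
have h0 : 0 < h by rewrite invr_gt0 ltr0n.
have hn0 : h != 0 by rewrite gt_eqF.
have hN : n.+1%:R = h `^ (- 1) :> R by rewrite powR_inv1 ?ltW// invrK.
have hm : n.+1%:R ^+ m = h `^ (- m%:R) :> R.
  by rewrite powR_invn ?ltW// exprVn invrK.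
set p := FD _ in FDlo *.
have p0 : 0 < p.
  by rewrite (lt_le_trans _ FDlo)// mulr_gt0 ?divr_gt0 ?powR_gt0.
have p1 : p <= 1 by exact: FD1.
apply/andP; split.
  by rewrite mulr_ge0 ?exprn_ge0// addr_ge0 ?exprn_ge0 ?subr_ge0.
have powRX (r : R) i : (h `^ r) ^+ i = h `^ (i%:R * r).
  by rewrite -powR_mulrn ?powR_ge0// -powRrM mulrC.
have powRm (r : R) : h `^ (r - m%:R) = n.+1%:R ^+ m * h `^ r.
  by rewrite hm mulrC powRD// hn0 implybT.
rewrite /B !powRm mulrDr lerD//.
  rewrite [leRHS]mulrCA ler_wpM2l ?exprn_ge0//.
  rewrite -powRX -exprMn lerXn2r ?nnegrE//; last by rewrite powRrM.
  by rewrite mulr_ge0 ?powR_ge0// mulr_ge0// ltW.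
rewrite [leRHS]mulrCA ler_wpM2l ?exprn_ge0//.
have /le_trans : (1 - p) ^+ n.+1 <= j`!%:R / (p * n.+1%:R) ^+ j.
  by rewrite exprB1_le_factorial// p0.
apply.
(* Both sides are turned into reciprocals of [j]-th powers, which leaves
   [cD / 2 * h ^ (s * bD - 1) <= p * N], that is [FDlo] multiplied by [N]. *)
rewrite -mulrA ler_wpM2l// -powRX -[h `^ _]invrK -powRN exprVn.
rewrite -invfM -exprMn.
have q0 : 0 < cD / 2 * h `^ (- (1 - s * bD)).
  by rewrite mulr_gt0 ?divr_gt0 ?powR_gt0.
have pN0 : 0 < p * n.+1%:R by rewrite mulr_gt0.
rewrite lef_pV2 ?posrE ?exprn_gt0// lerXn2r ?nnegrE ?(ltW q0) ?(ltW pN0)//.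
rewrite opprB powRD ?hn0 ?implybT// -hN mulrA ler_wpM2r//.
by rewrite powRrM.
Unshelve. all: by end_near. Qed.

(* Q n is the random matrix of size n.+1. *)
Theorem proposition7p3 (R : realType)
  (muD muO : probability (measurableTypeR R) R)
  (d : nat -> measure_display) (T : forall n, measurableType (d n))
  (P : forall n, probability (T n) R)
  (Q : forall n, 'M[{RV (P n) >-> R}]_n.+1)
  (a cD cO bD bO : R)
  (FD := distribution_function muD) (FO := distribution_function muO)
  (Qsym : forall n, (Q n)^T = Q n)
  (Qindep : forall n, mutually_independent
     [pred ij : 'I_n.+1 * 'I_n.+1 | (ij.1 <= ij.2)%N]
     (fun ij => Q n ij.1 ij.2))
  (QD : forall n (i : 'I_n.+1) (x : R), cdf (Q n i i) x = (FD x)%:E)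
  (QO : forall n (i j : 'I_n.+1) (x : R), (i < j)%N ->
     cdf (Q n i j) x = (FO x)%:E)
  (acD : muD `<< (@lebesgue_measure R))
  (acO : muO `<< (@lebesgue_measure R))
  (endD : lower_endpoint FD = (- a)%:E)
  (endO : lower_endpoint FO = (- a)%:E)
  (cD_gt0 : 0 < cD) (cO_gt0 : 0 < cO) (bD_gt0 : 0 < bD) (bO_gt0 : 0 < bO)
  (asympD : FD (- a + t) / (cD * t `^ bD) @[t --> 0^'+] --> (1 : R))
  (asympO : FO (- a + t) / (cO * t `^ bO) @[t --> 0^'+] --> (1 : R))
  (hb : 5 / 4 * bD < bO) :
  ((n.+1%:R ^+ 5)%:E * 'E_(P n)[fun w => (FO (min_diag (Q n) w) ^+ 4)%R])%E
    @[n --> \oo] --> (0 : \bar R).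
Proof.
(* This is [hb] rearranged so that a midpoint [s] yields both [s * bD < 1] and
   [5 < 4 * (s * bO)]. *)
have cond : 5 / (4 * bO) < bD^-1.
  rewrite ltr_pdivrMr ?mulr_gt0// mulrC -ltr_pdivrMr ?mulr_gt0 ?invr_gt0//.
  rewrite invrK; lra.
have [s /andP[s1 s2]] : exists s, 5 / (4 * bO) < s < bD^-1.
  by exists ((5 / (4 * bO) + bD^-1) / 2); rewrite !midf_lt.
have s0 : 0 < s by apply: lt_trans s1; rewrite divr_gt0 ?mulr_gt0.
have lim : n.+1%:R ^+ 5 * (FO (- a + n.+1%:R^-1 `^ s) ^+ 4 +
    (1 - FD (- a + n.+1%:R^-1 `^ s)) ^+ n.+1) @[n --> \oo] --> (0 : R).
  apply: (@threshold_bound_cvg0 _ _ _ _ cD cO bD bO) => //.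
  - by rewrite -ltr_pdivlMr// mul1r.
  - by rewrite mulrCA -ltr_pdivrMr ?mulr_gt0.
  - by move=> x; exact: distribution_function_le1.
  - by move=> x; exact: distribution_function_ge0.
(* Squeezing in the extended reals avoids a separate proof that the expectation is finite. *)
apply: (@squeeze_cvge _ _ _ _ (cst 0%E) _ (fun n => (n.+1%:R ^+ 5 *
    (FO (- a + n.+1%:R^-1 `^ s) ^+ 4 +
    (1 - FD (- a + n.+1%:R^-1 `^ s)) ^+ n.+1))%:E)); last 2 first.
- exact: cvg_cst.
- by apply: cvg_EFin; [exact: nearW|exact: lim].
near=> n; apply/andP; split.
  rewrite mule_ge0 ?lee_fin ?exprn_ge0// expectation_ge0// => w.
  by rewrite exprn_ge0 ?distribution_function_ge0.
rewrite [leRHS]EFinM lee_wpmul2l ?lee_fin ?exprn_ge0//.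
apply: expectation_min_diag_le => //.
- exact: distribution_function_nondecreasing.
- by move=> y; rewrite distribution_function_ge0 distribution_function_le1.
Unshelve. all: by end_near. Qed.
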